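(* Let $M=(S,\mathcal{I})$ be a matroid, $S_0\subseteq S$ a set containing a basis, and $w\in\mathbb{R}^S$. Let $B_0$ be a maximum $w$-weight basis of the restriction $M|S_0$, and let $w^*$ be an optimal solution of the Inverse Matroid instance $(M,B_0,w,\|\cdot\|_\infty)$. Then $w^*$ is an optimal solution of the IM-Exists instance $(M,S_0,w,\|\cdot\|_\infty)$, and it can be computed in polynomial time.
   Context: Inverse Matroid instance $(M,B,w,\|\cdot\|_\infty)$: find $w'\in\mathbb{R}^S$ such that the basis $B$ is a maximum $w'$-weight basis of $M$, minimizing $\|w-w'\|_\infty=\max_s|w(s)-w'(s)|$. IM-Exists instance $(M,S_0,w,\|\cdot\|_\infty)$: find $w'\in\mathbb{R}^S$ such that some basis of $M$ contained in $S_0$ is a maximum $w'$-weight basis, minimizing $\|w-w'\|_\infty$. $M|S_0$ is the restriction of $M$ to $S_0$. Polynomial time is measured in independence oracle calls and elementary operations. *)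

(* Defs.v *)
From HB Require Import structures.
From mathcomp Require Import all_boot all_order all_algebra reals.
Set Implicit Arguments.
Unset Strict Implicit.
Unset Printing Implicit Defensive.
Import Order.TTheory GRing.Theory Num.Theory.
Local Open Scope ring_scope.

(* [matroid E] is the type of matroids with ground set [E], given by their
   family of independent sets; [E] is a subset of an ambient finite type, so
   that a restriction of a matroid on [[set: T]] lives over the same [T]. *)
Record matroid (T : finType) (E : {set T}) := Matroid {
  indep : {set {set T}};
  indep_ground : forall A, A \in indep -> A \subset E;
  indep0 : set0 \in indep;
  indep_sub : forall A B : {set T}, A \subset B -> B \in indep -> A \in indep;
  indep_aug : forall A B : {set T}, A \in indep -> B \in indep ->
    (#|A| < #|B|)%N -> exists2 x, x \in B :\: A & x |: A \in indep }.

Section Restriction.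
Variables (T : finType) (E : {set T}) (M : matroid E) (F : {set T}).

Let restr_indep : {set {set T}} := [set A in indep M | A \subset F].

Fact restr_ground A : A \in restr_indep -> A \subset F.
Proof. by rewrite inE => /andP[]. Qed.

Fact restr_indep0 : set0 \in restr_indep.
Proof. by rewrite inE indep0 sub0set. Qed.

Fact restr_indep_sub (A B : {set T}) :
  A \subset B -> B \in restr_indep -> A \in restr_indep.
Proof.
move=> AB; rewrite !inE => /andP[IB BF].
by rewrite (indep_sub AB IB) (subset_trans AB BF).
Qed.

Fact restr_indep_aug (A B : {set T}) :
  A \in restr_indep -> B \in restr_indep -> (#|A| < #|B|)%N ->
  exists2 x, x \in B :\: A & x |: A \in restr_indep.
Proof.
rewrite !inE => /andP[IA AF] /andP[IB BF] ltAB.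
have [x xBA IxA] := indep_aug IA IB ltAB; exists x => //.
rewrite inE IxA subUset AF andbT sub1set (subsetP BF) //.
by move: xBA; rewrite inE => /andP[].
Qed.

Definition restriction : matroid F :=
  Matroid restr_ground restr_indep0 restr_indep_sub restr_indep_aug.

End Restriction.

Definition basis (T : finType) (E : {set T}) (M : matroid E) (B : {set T}) :
  bool := maxset (fun A => A \in indep M) B.

Section InverseMatroid.
Variables (R : realType) (S : finType).
Implicit Types (w : {ffun S -> R}) (B : {set S}).

Definition weight w B : R := \sum_(s in B) w s.

Definition max_weight_basis (E : {set S}) (M : matroid E) w B : Prop :=
  basis M B /\ forall B', basis M B' -> weight w B' <= weight w B.

Definition linf (v : {ffun S -> R}) : R := \big[Num.max/0]_(s : S) `|v s|.

Definition closest (feasible : {ffun S -> R} -> Prop) w w' : Prop :=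
  feasible w' /\ forall w'', feasible w'' -> linf (w - w') <= linf (w - w'').

Definition IM_optimal (M : matroid [set: S]) B w w' : Prop :=
  closest (fun v => max_weight_basis M v B) w w'.

Definition IM_exists_optimal (M : matroid [set: S]) (S0 : {set S}) w w' :
  Prop :=
  closest
    (fun v => exists2 B : {set S}, B \subset S0 & max_weight_basis M v B) w w'.

End InverseMatroid.

(* Model of computation: a real RAM with an independence oracle, presented as
   a while-language.  The memory consists of arrays of natural numbers (used
   for indices and subsets) and of arrays of real numbers.  Naturals have only
   addition, truncated subtraction and comparison, so that charging one unit
   per operation does not hide superpolynomial work; reals have the field
   operations and comparison, and no rounding. *)

Inductive nexp :=
  | NConst of nat
  | NGet of nat & nexp
  | NAdd of nexp & nexp
  | NSub of nexp & nexp.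

Inductive rexp :=
  | RConst of nat
  | RGet of nat & nexp
  | RAdd of rexp & rexp
  | RSub of rexp & rexp
  | RMul of rexp & rexp
  | RDiv of rexp & rexp.

Inductive bexp :=
  | NLe of nexp & nexp
  | RLe of rexp & rexp
  | BNot of bexp
  | BAnd of bexp & bexp.

(* [NSet a i e] and [RSet a i e] store [e] in cell [i] of array [a];
   [Query a i b] stores there the oracle's answer on the subset whose
   indicator is the array [b]. *)
Inductive cmd :=
  | Skip
  | NSet of nat & nexp & nexp
  | RSet of nat & nexp & rexp
  | Query of nat & nexp & nat
  | Seq of cmd & cmd
  | If of bexp & cmd & cmd
  | While of bexp & cmd.

Fixpoint nexp_cost (e : nexp) : nat :=
  match e with
  | NConst _ => 1
  | NGet _ i => (nexp_cost i).+1%N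
  | NAdd e1 e2 | NSub e1 e2 => (nexp_cost e1 + nexp_cost e2).+1%N
  end.

Fixpoint rexp_cost (e : rexp) : nat :=
  match e with
  | RConst _ => 1
  | RGet _ i => (nexp_cost i).+1%N
  | RAdd e1 e2 | RSub e1 e2 | RMul e1 e2 | RDiv e1 e2 =>
      (rexp_cost e1 + rexp_cost e2).+1%N
  end.

Fixpoint bexp_cost (e : bexp) : nat :=
  match e with
  | NLe e1 e2 => (nexp_cost e1 + nexp_cost e2).+1%N
  | RLe e1 e2 => (rexp_cost e1 + rexp_cost e2).+1%N
  | BNot e1 => (bexp_cost e1).+1%N
  | BAnd e1 e2 => (bexp_cost e1 + bexp_cost e2).+1%N
  end.

Section Semantics.
Variable R : realType.

Record state := State {
  nmem : nat -> nat -> nat;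
  rmem : nat -> nat -> R }.

Definition update (V : Type) (m : nat -> nat -> V) (a i : nat) (v : V) :
  nat -> nat -> V :=
  fun b j => if (b == a) && (j == i) then v else m b j.

Definition nset (st : state) a i v := State (update (nmem st) a i v) (rmem st).
Definition rset (st : state) a i v := State (nmem st) (update (rmem st) a i v).

Fixpoint neval (st : state) (e : nexp) : nat :=
  match e with
  | NConst k => k
  | NGet a i => nmem st a (neval st i)
  | NAdd e1 e2 => (neval st e1 + neval st e2)%N
  | NSub e1 e2 => (neval st e1 - neval st e2)%N
  end.

Fixpoint reval (st : state) (e : rexp) : R :=
  match e with
  | RConst k => k%:R
  | RGet a i => rmem st a (neval st i)
  | RAdd e1 e2 => reval st e1 + reval st e2
  | RSub e1 e2 => reval st e1 - reval st e2
  | RMul e1 e2 => reval st e1 * reval st e2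
  | RDiv e1 e2 => reval st e1 / reval st e2
  end.

Fixpoint beval (st : state) (e : bexp) : bool :=
  match e with
  | NLe e1 e2 => (neval st e1 <= neval st e2)%N
  | RLe e1 e2 => reval st e1 <= reval st e2
  | BNot e1 => ~~ beval st e1
  | BAnd e1 e2 => beval st e1 && beval st e2
  end.

Variable oracle : (nat -> nat) -> bool.

(* [exec c st k st']: started in [st], the command [c] terminates in [st']
   after [k] oracle calls and elementary operations. *)
Inductive exec : cmd -> state -> nat -> state -> Prop :=
  | ExecSkip st : exec Skip st 0 st
  | ExecNSet st a i e :
      exec (NSet a i e) st (nexp_cost i + nexp_cost e).+1%N
        (nset st a (neval st i) (neval st e))
  | ExecRSet st a i e :
      exec (RSet a i e) st (nexp_cost i + rexp_cost e).+1%N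
        (rset st a (neval st i) (reval st e))
  | ExecQuery st a i b :
      exec (Query a i b) st (nexp_cost i).+1
        (nset st a (neval st i) (oracle (nmem st b)))
  | ExecSeq c1 c2 st st1 st2 k1 k2 :
      exec c1 st k1 st1 -> exec c2 st1 k2 st2 ->
      exec (Seq c1 c2) st (k1 + k2)%N st2
  | ExecIfTrue b c1 c2 st st' k :
      beval st b -> exec c1 st k st' ->
      exec (If b c1 c2) st (bexp_cost b + k)%N st'
  | ExecIfFalse b c1 c2 st st' k :
      ~~ beval st b -> exec c2 st k st' ->
      exec (If b c1 c2) st (bexp_cost b + k)%N st'
  | ExecWhileTrue b c st st1 st2 k1 k2 :
      beval st b -> exec c st k1 st1 -> exec (While b c) st1 k2 st2 ->
      exec (While b c) st (bexp_cost b + k1 + k2)%N st2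
  | ExecWhileFalse b c st :
      ~~ beval st b -> exec (While b c) st (bexp_cost b) st.

Definition terminates_within (c : cmd) (st : state) (bound : nat)
    (post : state -> Prop) : Prop :=
  exists k st', [/\ exec c st k st', (k <= bound)%N & post st'].

End Semantics.

(* The element [s] of the ground set is represented by the natural number
   [enum_rank s]; a subset is an array that is nonzero exactly at the ranks of
   its elements. *)
Section Encoding.
Variables (R : realType) (S : finType).

Definition array_of (V : Type) (v0 : V) (f : S -> V) : nat -> V :=
  fun i => if insub i : option 'I_#|S| is Some j then f (enum_val j) else v0.

Definition set_of_array (a : nat -> nat) : {set S} :=
  [set s | a (enum_rank s) != 0%N].

Definition vector_of_array (a : nat -> R) : {ffun S -> R} :=
  [ffun s => a (enum_rank s)].

Definition indep_oracle (M : matroid [set: S]) (a : nat -> nat) : bool :=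
  set_of_array a \in indep M.

(* Input layout: natural arrays 0, 1 and 2 hold the size of the ground set (in
   cell 0), [S0] and [B]; real array 0 holds [w]; all other cells are 0. *)
Definition input (S0 B : {set S}) (w : {ffun S -> R}) : state R :=
  State
    (fun a => match a with
      | 0 => fun i => if i == 0%N then #|S| else 0%N
      | 1 => array_of 0%N (fun s => nat_of_bool (s \in S0))
      | 2 => array_of 0%N (fun s => nat_of_bool (s \in B))
      | _ => fun=> 0%N
      end)
    (fun a => if a == 0%N then array_of 0 w else fun=> 0).

(* Output layout: natural array 2 holds the basis, real array 1 the new
   weights. *)
Definition output_basis (st : state R) : {set S} := set_of_array (nmem st 2).

Definition output_weight (st : state R) : {ffun S -> R} :=
  vector_of_array (rmem st 1).

End Encoding.

(* Main.v *)
(* A basis is of maximum weight iff no exchange increases its weight.  Let [D]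
   be the largest gap [w s - w t] over the exchanges of [B] trading [t] for [s]
   (or 0 if all gaps are negative).  Raising [w] by [D / 2] on [B] and lowering
   it by [D / 2] elsewhere makes [B] of maximum weight, and any [w'] that does
   so is at distance at least [D / 2], since [w' s <= w' t].  If [B0] is a
   maximum [w]-weight basis inside [S0] and [w''] makes some basis [B] inside
   [S0] of maximum weight, then every gap of [B0] is also bounded by a gap of
   [B], so that [D / 2 <= linf (w - w'')].  The gaps are computed with one
   oracle call per pair of elements, and [B0] by the greedy algorithm. *)

Require Import Defs.
From HB Require Import structures.
From mathcomp Require Import all_boot all_order all_algebra reals.
From mathcomp Require Import zify ring lra.
Set Implicit Arguments.
Unset Strict Implicit.
Unset Printing Implicit Defensive.
Import Order.TTheory GRing.Theory Num.Theory.
Local Open Scope ring_scope.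

(** * Exchanges and optimality *)

Section Matroid.
Variables (T : finType) (E : {set T}) (M : matroid E).
Implicit Types (A B X : {set T}) (s t : T).

(** Iterates augmentation, by induction on the deficit [#|B| - #|A|]. *)
Lemma indep_extend A B : A \in indep M -> B \in indep M -> (#|A| <= #|B|)%N ->
  exists I, [/\ I \in indep M, A \subset I, I \subset A :|: B & #|I| = #|B|].
Proof.
move=> + IB; have [m] := ubnP (#|B| - #|A|); elim: m A => // m IHm A ltm IA leAB.
have [ltAB | geAB] := ltnP #|A| #|B|; last first.
  by exists A; split=> //; [exact: subsetUl | lia].
have [x /setDP[xB xNA] IxA] := indep_aug IA IB ltAB.
have cxA : #|x |: A| = #|A|.+1 by rewrite cardsU1 xNA.
have [||I [II AI IAB cI]] := IHm (x |: A) _ IxA; rewrite ?cxA //; first by lia.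
exists I; split=> //; first exact: subset_trans (subsetUr _ _) AI.
apply: subset_trans IAB _; rewrite subUset subsetUr andbT subUset subsetUl andbT.
by rewrite sub1set inE xB orbT.
Qed.

Lemma basis_indep B : basis M B -> B \in indep M.
Proof. by case/maxsetP. Qed.

Lemma indep_leq_basis A B : A \in indep M -> basis M B -> (#|A| <= #|B|)%N.
Proof.
move=> IA /maxsetP[IB maxB]; rewrite leqNgt; apply/negP=> ltBA.
have [x /setDP[_ xNB] IxB] := indep_aug IB IA ltBA.
by move: xNB; rewrite -(maxB _ IxB (subsetUr _ _)) setU11.
Qed.

Lemma basis_leq_card A B :
  A \in indep M -> basis M B -> (#|B| <= #|A|)%N -> basis M A.
Proof.
move=> IA bB leBA; apply/maxsetP; split=> // A' IA' AA'.
apply/esym/eqP; rewrite eqEcard AA'.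
exact: leq_trans (indep_leq_basis IA' bB) leBA.
Qed.

Lemma card_exchange B s t : t \in B -> s \notin B -> #|s |: B :\ t| = #|B|.
Proof.
move=> tB sNB; rewrite cardsU1 (cardsD1 t B) tB.
by rewrite !inE (negbTE sNB) andbF.
Qed.

(** [X] is a part of [B] to be kept. Filling [s |: X] up from [B] to the size of [B] leaves out, by
    cardinality, exactly one element [t] of [B], and [t] lies outside [X]. *)
Lemma basis_exchange B X s : basis M B -> s \notin B -> X \subset B ->
  s |: X \in indep M ->
  exists t, [/\ t \in B, t \notin X & s |: B :\ t \in indep M].
Proof.
move=> bB sNB XB IsX.
have [I [II sXI IsXB cI]] :=
  indep_extend IsX (basis_indep bB) (indep_leq_basis IsX bB).
have sI : s \in I by apply: (subsetP sXI); rewrite setU11.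
have IsB : I \subset s |: B.
  by apply: subset_trans IsXB _; rewrite -setUA (setUidPr XB).
have : B :\: I != set0.
  rewrite setD_eq0; apply/negP=> BI.
  move: sNB; suff -> : B = I by rewrite sI.
  by apply/eqP; rewrite eqEcard BI cI /=.
case/set0Pn=> t /setDP[tB tNI]; exists t; split=> //.
  by apply: contra tNI => tX; apply: (subsetP sXI); rewrite inE tX orbT.
suff -> : s |: B :\ t = I by [].
apply/esym/eqP; rewrite eqEcard card_exchange // cI leqnn andbT.
apply/subsetP=> x xI; have := subsetP IsB x xI; rewrite !inE.
by case: (x =P t) xI tNI => [->->|].
Qed.

Lemma basis_exchangeP B s t : basis M B -> t \in B -> s \notin B ->
  s |: B :\ t \in indep M -> basis M (s |: B :\ t).
Proof.
by move=> bB tB sNB I; apply: basis_leq_card I bB _; rewrite card_exchange.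
Qed.

End Matroid.

(** [B] is independent in the restriction, so [B0] has at least its cardinality. *)
Lemma basis_restriction (T : finType) (E : {set T}) (M : matroid E)
    (F B B0 : {set T}) : basis M B -> B \subset F ->
  basis (restriction M F) B0 -> B0 \subset F /\ basis M B0.
Proof.
move=> bB BF b0; have := basis_indep b0; rewrite inE => /andP[I0 B0F].
split=> //; apply: (basis_leq_card I0 bB); apply: (indep_leq_basis _ b0).
by rewrite inE (basis_indep bB).
Qed.


Section Optimality.
Variables (R : realType) (S : finType).
Implicit Types (w v : {ffun S -> R}) (B : {set S}) (s t : S).

Lemma weight_exchange v B s t : t \in B -> s \notin B ->
  weight v (s |: B :\ t) = weight v B - v t + v s.
Proof.
move=> tB sNB; rewrite /weight big_setU1 ?inE ?(negbTE sNB) ?andbF //=.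
by rewrite (big_setD1 t tB) /=; ring.
Qed.

(** The case [d = 0] is local optimality of [B] under exchanges. *)
Definition exchange_bound (E : {set S}) (M : matroid E) B w (d : R) : Prop :=
  forall t s, t \in B -> s \notin B -> s |: B :\ t \in indep M ->
  w s - w t <= d.

Lemma max_weight_exchange (E : {set S}) (M : matroid E) v B :
  max_weight_basis M v B -> exchange_bound M B v 0.
Proof.
case=> bB maxB t s tB sNB I; have := maxB _ (basis_exchangeP bB tB sNB I).
by rewrite weight_exchange //; lra.
Qed.

(* If [t] is heaviest in [B :\: B'], every exchange bringing [t] into [B'] is
   nondecreasing: the element [s] it removes can itself be exchanged into [B]
   against some [t'] in [B :\: B'], whence [v s <= v t' <= v t]. *)
Lemma exchange_max_weight (E : {set S}) (M : matroid E) v B :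
  basis M B -> exchange_bound M B v 0 -> max_weight_basis M v B.
Proof.
(* Induction on [#|B :\: B'|]: each exchange moves [B'] one element closer to [B]. *)
move=> bB loc; split=> // B'; have [m] := ubnP #|B :\: B'|.
elim: m B' => // m IHm B' ltm bB'.
have [BB' | [t0 t0BB']] := set_0Vmem (B :\: B').
  suff -> : B' = B by [].
  apply/esym/eqP; rewrite eqEcard (indep_leq_basis (basis_indep bB') bB) andbT.
  by rewrite -setD_eq0 BB'.
have [t /setDP[tB tNB'] tmax] := @arg_maxP _ R S t0 [in B :\: B'] v t0BB'.
have I1 : t |: (B :&: B') \in indep M.
  apply: (indep_sub _ (basis_indep bB)).
  by rewrite subUset sub1set tB subsetIl.
have [s [sB' sNBB' I]] := basis_exchange bB' tNB' (subsetIr B B') I1.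
have sNB : s \notin B by move: sNBB'; rewrite inE sB' andbT.
have I2 : s |: (B :&: B') \in indep M.
  apply: (indep_sub _ (basis_indep bB')).
  by rewrite subUset sub1set sB' subsetIr.
have [t' [t'B t'NBB' I']] := basis_exchange bB sNB (subsetIl B B') I2.
have t'BB' : t' \in B :\: B' by move: t'NBB'; rewrite !inE t'B andbT.
have := loc _ _ t'B sNB I'; have /= := tmax _ t'BB' => le1 le2.
apply: le_trans (_ : weight v (t |: B' :\ s) <= _).
  by rewrite weight_exchange //; lra.
apply: IHm; last exact: (basis_exchangeP bB' sB' tNB' I).
apply: leq_trans (_ : #|B :\: B'| <= m)%N; last by rewrite -ltnS.
apply: proper_card; apply/properP; split.
  apply/subsetP=> x; rewrite !inE; case: eqP => //= _.
  case: (x =P s) => [->|] //=; by rewrite (negbTE sNB).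
by exists t; rewrite !inE ?tB ?tNB' ?eqxx.
Qed.

(** * Sup-norm distance and shifted weights *)

Lemma linf_ge v s : `|v s| <= linf v.
Proof. by rewrite /linf (bigD1 s) //= le_max lexx. Qed.

Lemma linf_le v d : 0 <= d -> (forall s, `|v s| <= d) -> linf v <= d.
Proof.
move=> d0 vd; apply: (big_ind (fun x => x <= d)) => // x y xd yd.
by rewrite ge_max xd.
Qed.

Lemma linf_ge0 v : 0 <= linf v.
Proof.
by apply: (big_ind (fun x => 0 <= x)) => // x y x0 y0; rewrite le_max x0.
Qed.

Lemma linf_dist w v s : w s - linf (w - v) <= v s <= w s + linf (w - v).
Proof.
by have := linf_ge (w - v) s; rewrite !ffunE ler_norml => /andP[]; lra.
Qed.

Definition shift w B (d : R) : {ffun S -> R} :=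
  [ffun s => if s \in B then w s + d else w s - d].

Lemma linf_shift w B d : 0 <= d -> linf (w - shift w B d) <= d.
Proof.
by move=> d0; apply: linf_le => // s; rewrite !ffunE ler_norml; case: ifP; lra.
Qed.

Lemma shift_max_weight (E : {set S}) (M : matroid E) B w d : basis M B ->
  exchange_bound M B w (d *+ 2) -> max_weight_basis M (shift w B d) B.
Proof.
move=> bB gap; apply: exchange_max_weight => // t s tB sNB I.
by have := gap t s tB sNB I; rewrite !ffunE tB (negbTE sNB) mulr2n; lra.
Qed.

(** Any [v] making [B] optimal has [v s <= v t] on exchanges, so [linf (w - v)] is an admissible
    [d'] in the minimality hypothesis. *)
Lemma IM_optimal_shift (M : matroid [set: S]) B w d : basis M B -> 0 <= d ->
  exchange_bound M B w (d *+ 2) ->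
  (forall d', 0 <= d' -> exchange_bound M B w (d' *+ 2) -> d <= d') ->
  IM_optimal M B w (shift w B d).
Proof.
move=> bB d0 gap least; split; first exact: shift_max_weight.
move=> v /max_weight_exchange loc; apply: le_trans (linf_shift w B d0) _.
apply: least; first exact: linf_ge0.
move=> t s tB sNB I; have := loc t s tB sNB I.
have /andP[] := linf_dist w v s; have /andP[] := linf_dist w v t.
by rewrite mulr2n; lra.
Qed.

(* For an exchange [t], [s] of [B0] with [w t < w s], the elements of [S0]
   heavier than [t] are spanned by those of [B0], hence do not span [s]; so [s]
   can enter [B] against some [u] no heavier than [t]. *)
Lemma exists_exchange_bound (M : matroid [set: S]) (S0 B0 B : {set S}) w v :
  B \subset S0 -> max_weight_basis M v B ->
  max_weight_basis (restriction M S0) w B0 ->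
  exchange_bound M B0 w (linf (w - v) *+ 2).
Proof.
move=> BS0 [bB maxB] mB0; have [b0 _] := mB0; have loc0 := max_weight_exchange mB0.
have [B0S0 bB0] := basis_restriction bB BS0 b0.
move=> t s tB0 sNB0 I.
have [le_st | lt_ts] := leP (w s) (w t).
  by have := linf_ge0 (w - v); rewrite mulr2n; lra.
(* If [s] were in [B], it would lie in [S0], and the exchange would improve [B0] within [S0]. *)
have sNB : s \notin B.
  apply/negP=> sB; have := loc0 t s tB0 sNB0; rewrite inE I /=.
  rewrite subUset sub1set (subsetP BS0) //= (subset_trans (subsetDl _ _)) //.
  by move/(_ isT); lra.
pose H := [set x in S0 | w t < w x].
pose X := B0 :&: H.
(* [X] has maximum size among the independent subsets of [H]: otherwise some [y] in [H] could
   replace in [B0] an element [z] outside [H], with [w z <= w t < w y]. *)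
have leX A : A \in indep M -> A \subset H -> (#|A| <= #|X|)%N.
  move=> IA AH; rewrite leqNgt; apply/negP=> ltXA.
  have IX : X \in indep M by apply: indep_sub (subsetIl _ _) (basis_indep bB0).
  have [y /setDP[yA yNX] IyX] := indep_aug IX IA ltXA.
  have yH := subsetP AH y yA.
  have yNB0 : y \notin B0 by move: yNX; rewrite inE yH andbT.
  have [z [zB0 zNX Iz]] := basis_exchange bB0 yNB0 (subsetIl _ _) IyX.
  have yS0 : y \in S0 by move: yH; rewrite inE => /andP[].
  have := loc0 z y zB0 yNB0; rewrite inE Iz subUset sub1set yS0 /=.
  rewrite (subset_trans (subsetDl _ _)) // => /(_ isT).
  move: zNX yH; rewrite !inE zB0 (subsetP B0S0) //= -leNgt yS0 /=; lra.
have IY : B :&: H \in indep M by apply: indep_sub (subsetIl _ _) (basis_indep bB).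
have [|Y /maxsetP[/andP[IY' YH] maxY] sY] :=
  @maxset_exists _ (fun A => (A \in indep M) && (A \subset H)) (B :&: H).
  by rewrite IY subsetIr.
have sX : s |: X \subset s |: B0 :\ t.
  apply: setUS; apply/subsetP=> x; rewrite !inE => /and3P[-> _ ltx].
  by case: eqP ltx => // ->; rewrite ltxx.
(* Since [#|Y| <= #|X| < #|s |: X|], [Y] can be augmented from [s |: X]; as [Y] is maximal within
   [H], the new element is [s]. *)
have [|y] := indep_aug IY' (indep_sub sX I).
  rewrite cardsU1 inE (negbTE sNB0) /= add1n ltnS; exact: leX.
rewrite !inE => /andP[yNY /orP[/eqP-> IsY | /andP[yB0 yH] IyY]]; last first.
  case/negP: yNY; rewrite -(maxY (y |: Y)) ?setU11 ?subsetUr //.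
  by rewrite IyY subUset YH sub1set inE yH.
(* Keeping [B :&: H] forces the removed [u] out of [H], so [w u <= w t]. With [d = linf (w - v)]
   this gives [w s - d <= v s <= v u <= w u + d <= w t + d]. *)
have [u [uB uNBH Iu]] := basis_exchange bB sNB (subsetIl B H)
  (indep_sub (setUS [set s] sY) IsY).
have := max_weight_exchange (conj bB maxB) uB sNB Iu.
move: uNBH; rewrite !inE uB (subsetP BS0) //= -leNgt.
have /andP[] := linf_dist w v s; have /andP[] := linf_dist w v u.
by rewrite mulr2n; lra.
Qed.

(** A competitor [v] is replaced by the shift of [w] along [B0] by [linf (w - v)]. The shift is
    feasible for [B0] and no farther from [w] than [v], so the optimality of [wstar] for [B0]
    applies to it. *)
Lemma IM_exists_of_IM (M : matroid [set: S]) (S0 : {set S}) w :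
  (exists2 B, basis M B & B \subset S0) ->
  forall (B0 : {set S}) (wstar : {ffun S -> R}),
  max_weight_basis (restriction M S0) w B0 ->
  IM_optimal M B0 w wstar -> IM_exists_optimal M S0 w wstar.
Proof.
move=> [A bA AS0] B0 wstar mB0 [feas opt]; have [b0 _] := mB0.
have [B0S0 bB0] := basis_restriction bA AS0 b0.
split; first by exists B0.
move=> v [B BS0 mB]; have gap := exists_exchange_bound BS0 mB mB0.
apply: le_trans (opt _ (shift_max_weight bB0 gap)) _.
exact: linf_shift (linf_ge0 _).
Qed.

(** * Greedy algorithm *)

(* [U] is the set of unscanned elements of [S0]. *)
Record greedy_inv (E : {set S}) (M : matroid E) (S0 : {set S})
    w (U B : {set S}) : Prop := {
  greedy_indep : B \in indep M;
  greedy_subU : U \subset S0;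
  greedy_subB : B \subset S0 :\: U;
  greedy_sorted : forall u s, u \in U -> s \in S0 :\: U -> w u <= w s;
  greedy_span : forall s, s \in S0 :\: U -> s \notin B ->
    s |: [set b in B | w s <= w b] \notin indep M }.

Lemma greedy_inv0 (E : {set S}) (M : matroid E) (S0 : {set S}) w :
  greedy_inv M S0 w S0 set0.
Proof.
split; rewrite ?indep0 ?sub0set ?setDv //.
  by move=> u s _; rewrite inE.
by move=> s; rewrite inE.
Qed.

(** Insertions only enlarge the sets that witness earlier rejections. If [e] is rejected, all of [B]
    is at least as heavy as [e], so [B] itself is the witness. *)
Lemma greedy_inv_step (E : {set S}) (M : matroid E) (S0 : {set S}) w
    (U B : {set S}) e :
  greedy_inv M S0 w U B -> e \in U -> (forall u, u \in U -> w u <= w e) ->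
  greedy_inv M S0 w (U :\ e) (if e |: B \in indep M then e |: B else B).
Proof.
move=> [IB US0 BU sorted span] eU emax.
have eS0 := subsetP US0 e eU.
have DU : S0 :\: (U :\ e) = e |: (S0 :\: U).
  by apply/setP=> x; rewrite !inE; case: eqP => // ->; rewrite eS0.
have US0' : U :\ e \subset S0 by apply: subset_trans (subsetDl _ _) US0.
have sorted' u s : u \in U :\ e -> s \in S0 :\: (U :\ e) -> w u <= w s.
  rewrite DU => /setD1P[_ uU] /setU1P[-> | sU]; [exact: emax | exact: sorted].
have eNB : e \notin B by apply/negP=> /(subsetP BU); rewrite inE eU.
case: ifP => IeB; split=> //.
- by rewrite DU setUS.
- move=> s; rewrite DU => /setU1P[-> | sU]; first by rewrite setU11.
  rewrite in_setU1 => /norP[_ sNB].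
  apply: contra (span s sU sNB); apply: indep_sub; apply: setUS.
  by apply/subsetP=> x; rewrite !inE => /andP[-> ->]; rewrite orbT.
- by rewrite DU (subset_trans BU) // subsetUr.
- move=> s; rewrite DU => /setU1P[-> _ | sU sNB]; last exact: span.
  apply/negP=> I; case/negP: (negbT IeB); apply: indep_sub I; apply: setUS.
  by apply/subsetP=> b bB; rewrite inE bB sorted // (subsetP BU).
Qed.

Lemma greedy_inv_max_weight (E : {set S}) (M : matroid E) (S0 : {set S}) w B :
  greedy_inv M S0 w set0 B -> max_weight_basis (restriction M S0) w B.
Proof.
move=> [IB _]; rewrite setD0 => BS0 _ span.
(* Used with [X = B] to show that [B] is a basis, and with [X = B :\ t], where the missed element
   must be [t], to bound the gap of an exchange. *)
have dep s X : s \in S0 -> s \notin B -> s |: X \in indep M ->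
    exists2 b, b \in B & (w s <= w b) && (b \notin X).
  move=> sS0 sNB IsX; have /subsetPn[b] : ~~ ([set b in B | w s <= w b] \subset X).
    by apply: contra (span s sS0 sNB) => sub; apply: indep_sub (setUS _ sub) IsX.
  by rewrite inE => /andP[bB le_sb] bNX; exists b; rewrite ?le_sb.
apply: exchange_max_weight.
  apply/maxsetP; split=> [|A]; first by rewrite inE IB.
  rewrite inE => /andP[IA AS0] BA; apply/eqP; rewrite eqEsubset BA andbT.
  apply/subsetP=> s sA; apply: contraT => sNB.
  have [||b bB /andP[_]] := dep s B _ sNB; rewrite ?(subsetP AS0) ?bB //.
  by apply: indep_sub IA; rewrite subUset sub1set sA.
move=> t s tB sNB; rewrite inE subUset sub1set => /and3P[I sS0 _].
have [b bB /andP[le_sb]] := dep _ _ sS0 sNB I.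
by rewrite !inE bB andbT negbK => /eqP <-; lra.
Qed.

End Optimality.

(** * Running time of commands *)

(** A scalar variable is cell 0 of an array, named by the number of the array. *)
Definition nvar a : nexp := NGet a (NConst 0).
Definition rvar a : rexp := RGet a (NConst 0).

(** In the input layout the bound [nvar 0] is the size of the ground set. *)
Definition for_loop (x : nat) (body : cmd) : cmd :=
  Seq (NSet x (NConst 0) (NConst 0))
    (While (NLe (NAdd (nvar x) (NConst 1)) (nvar 0))
      (Seq body (NSet x (NConst 0) (NAdd (nvar x) (NConst 1))))).

Section Hoare.
Variables (R : realType) (oracle : (nat -> nat) -> bool).
Implicit Types (c : cmd) (st : state R).

Fixpoint loop_free c : bool :=
  match c with
  | Seq c1 c2 | If _ c1 c2 => loop_free c1 && loop_free c2
  | While _ _ => false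
  | _ => true
  end.

(* Junk value: a loop is skipped. *)
Fixpoint run c st : state R :=
  match c with
  | Skip | While _ _ => st
  | NSet a i e => nset st a (neval st i) (neval st e)
  | RSet a i e => rset st a (neval st i) (reval st e)
  | Query a i b => nset st a (neval st i) (oracle (nmem st b))
  | Seq c1 c2 => run c2 (run c1 st)
  | If b c1 c2 => if beval st b then run c1 st else run c2 st
  end.

(** A conditional is charged its dearer branch and a loop counts 0, so this bounds the running time
    of loop-free commands only. *)
Fixpoint max_cost c : nat :=
  match c with
  | Skip | While _ _ => 0
  | NSet a i e => (nexp_cost i + nexp_cost e).+1
  | RSet a i e => (nexp_cost i + rexp_cost e).+1
  | Query a i b => (nexp_cost i).+1
  | Seq c1 c2 => max_cost c1 + max_cost c2
  | If b c1 c2 => bexp_cost b + maxn (max_cost c1) (max_cost c2)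
  end%N.

(** Loop-free code always halts, so its specification reduces to evaluating [run]. *)
Lemma terminates_run c st (P : state R -> Prop) :
  loop_free c -> P (run c st) ->
  terminates_within oracle c st (max_cost c) P.
Proof.
move=> lf Pst.
have [k ex_c le_k] : exists2 k, exec oracle c st k (run c st) & (k <= max_cost c)%N.
  elim: c st lf {Pst} => [|a i e|a i e|a i b|c1 IH1 c2 IH2|b c1 IH1 c2 IH2|//] st /=.
  - by exists 0%N => //; constructor.
  - by move=> _; eexists; first constructor.
  - by move=> _; eexists; first constructor.
  - by move=> _; eexists; first constructor.
  - case/andP=> /(IH1 st)[k1 ex1 le1] /(IH2 (run c1 st))[k2 ex2 le2].
    by exists (k1 + k2)%N; [apply: ExecSeq ex1 ex2 | exact: leq_add].
  - case/andP=> /(IH1 st)[k1 ex1 le1] /(IH2 st)[k2 ex2 le2].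
    case: ifP => [bT | /negbT bF].
      exists (bexp_cost b + k1)%N; first exact: ExecIfTrue.
      by rewrite leq_add2l leq_max le1.
    exists (bexp_cost b + k2)%N; first exact: ExecIfFalse.
    by rewrite leq_add2l leq_max le2 orbT.
by exists k, (run c st).
Qed.

Lemma terminates_weaken c st k k' (P Q : state R -> Prop) :
  terminates_within oracle c st k P -> (k <= k')%N ->
  (forall st', P st' -> Q st') -> terminates_within oracle c st k' Q.
Proof.
move=> [l [st' [ex_c le_l Pst']]] le_k PQ; exists l, st'.
by split; [|exact: leq_trans le_k | exact: PQ].
Qed.

Lemma terminates_seq c1 c2 st k1 k2 (P Q : state R -> Prop) :
  terminates_within oracle c1 st k1 P ->
  (forall st1, P st1 -> terminates_within oracle c2 st1 k2 Q) ->
  terminates_within oracle (Seq c1 c2) st (k1 + k2) Q.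
Proof.
move=> [l1 [st1 [ex1 le1 Pst1]]] /(_ _ Pst1)[l2 [st2 [ex2 le2 Qst2]]].
by exists (l1 + l2)%N, st2; split=> //; [apply: ExecSeq ex1 ex2 | apply: leq_add].
Qed.

(* [13] pays for the test and the increment, [10] for the initialization and the
   last test. *)
Lemma terminates_for (x n k : nat) (body : cmd) (Inv : nat -> state R -> Prop) st :
  x != 0%N -> nmem st 0 0 = n -> Inv 0%N (nset st x 0 0) ->
  (forall i st, (i < n)%N -> nmem st x 0 = i -> nmem st 0 0 = n -> Inv i st ->
    terminates_within oracle body st k (fun st' =>
      [/\ nmem st' x 0 = i, nmem st' 0 0 = n & Inv i.+1 (nset st' x 0 i.+1)])) ->
  terminates_within oracle (for_loop x body) st (n * (k + 13) + 10)
    (fun st' => nmem st' 0 0 = n /\ Inv n st').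
Proof.
move=> x0 st_n Inv0 step.
have nmem0 st1 v : nmem (nset st1 x 0 v) 0 0 = nmem st1 0 0.
  by rewrite /= /update eq_sym (negbTE x0).
have nmemx st1 v : nmem (nset st1 x 0 v) x 0 = v by rewrite /= /update !eqxx.
(* Induction on the number [m] of iterations left. *)
have loop m : forall i st1, (i + m)%N = n -> nmem st1 x 0 = i ->
    nmem st1 0 0 = n -> Inv i st1 ->
    terminates_within oracle (While (NLe (NAdd (nvar x) (NConst 1)) (nvar 0))
      (Seq body (NSet x (NConst 0) (NAdd (nvar x) (NConst 1))))) st1
      (m * (k + 13) + 7) (fun st' => nmem st' 0 0 = n /\ Inv n st').
  elim: m => [|m IHm] i st1 imn st1_i st1_n Inv_i.
    exists 7%N, st1; split; rewrite -?{2}imn ?addn0 //.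
    by apply: ExecWhileFalse => /=; rewrite st1_i st1_n -imn; lia.
  have [|l1 [st2 [ex1 le1 [st2_i st2_n Inv2]]]] := step i st1 _ st1_i st1_n Inv_i.
    by lia.
  have [|||l2 [st3 [ex2 le2 post]]] := IHm i.+1 (nset st2 x 0 i.+1) _ _ _ Inv2.
  - by rewrite addSnnS.
  - exact: nmemx.
  - by rewrite nmem0.
  (* The guard costs 7 and the increment 6. *)
  exists (7 + (l1 + 6) + l2)%N, st3; split=> //; last by rewrite mulSn; lia.
  apply: (ExecWhileTrue (k1 := (l1 + 6)%N)) ex2.
    by rewrite /= st1_i st1_n; lia.
  apply: ExecSeq ex1 _.
  have -> : i.+1 = neval st2 (NAdd (nvar x) (NConst 1)) by rewrite /= st2_i addn1.
  exact: ExecNSet.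
have := terminates_run (c := NSet x (NConst 0) (NConst 0)) (st := st)
  (P := fun st' => st' = nset st x 0 0) isT erefl.
move/terminates_seq=> /(_ _ (n * (k + 13) + 7)%N
  (fun st' => nmem st' 0 0 = n /\ Inv n st')) tw.
apply: terminates_weaken (tw _ _) _ _ => [st1 ->||//]; last by rewrite /=; lia.
by apply: loop; rewrite ?nmem0 ?nmemx //; exact: add0n.
Qed.

End Hoare.

(** * Ranks of elements and indicator arrays *)

Lemma eq_enum_rank (S : finType) (s t : S) :
  (enum_rank s == enum_rank t :> nat) = (s == t).
Proof. exact: (inj_eq (inj_comp val_inj enum_rank_inj)). Qed.

Lemma ltn_enum_rank (S : finType) i :
  (i < #|S|)%N -> exists s : S, enum_rank s = i :> nat.
Proof. by move=> ltiS; exists (enum_val (Ordinal ltiS)); rewrite enum_valK. Qed.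

Lemma enum_rank_ltnS (S : finType) (s t : S) :
  (enum_rank s < (enum_rank t).+1)%N = (s == t) || (enum_rank s < enum_rank t)%N.
Proof. by rewrite ltnS leq_eqVlt eq_enum_rank. Qed.

Lemma array_of_enum_rank (V : Type) (v0 : V) (S : finType) (f : S -> V) s :
  array_of v0 f (enum_rank s) = f s.
Proof. by rewrite /array_of valK enum_rankK. Qed.

Lemma updateE (V : Type) (m : nat -> nat -> V) a i v b j :
  update m a i v b j = if (b == a) && (j == i) then v else m b j.
Proof. by []. Qed.

Section StateSets.
Variable S : finType.

Lemma set_of_array_update (m : nat -> nat -> nat) a (e : S) v b :
  set_of_array S (update m a (enum_rank e) v b) =
  if b == a then
    if v == 0%N then set_of_array S (m b) :\ e else e |: set_of_array S (m b)
  else set_of_array S (m b).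
Proof.
apply/setP=> s; rewrite inE /update eq_enum_rank.
have [_ | _] := eqVneq b a; last by rewrite inE.
by have [-> | v0] := eqVneq v 0%N; rewrite !inE; case: (s == e).
Qed.

Lemma set_of_array_nat_of_bool (A : {set S}) :
  set_of_array S (array_of 0%N (fun s => nat_of_bool (s \in A))) = A.
Proof. by apply/setP=> s; rewrite inE array_of_enum_rank eqb0 negbK. Qed.

End StateSets.

(** * The algorithms *)

(* Loop indices are natural variables 3 and 4, the oracle's answer is natural
   variable 5, and real variable 2 is twice the shift. *)
Definition gap_step : cmd :=
  If (BAnd (NLe (NConst 1) (NGet 2 (nvar 3))) (NLe (NGet 2 (nvar 4)) (NConst 0)))
    (Seq (NSet 2 (nvar 3) (NConst 0))
    (Seq (NSet 2 (nvar 4) (NConst 1))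
    (Seq (Query 5 (NConst 0) 2)
    (Seq (NSet 2 (nvar 4) (NConst 0))
    (Seq (NSet 2 (nvar 3) (NConst 1))
      (If (BAnd (NLe (NConst 1) (nvar 5))
             (BNot (RLe (RSub (RGet 0 (nvar 4)) (RGet 0 (nvar 3))) (rvar 2))))
        (RSet 2 (NConst 0) (RSub (RGet 0 (nvar 4)) (RGet 0 (nvar 3))))
        Skip))))))
    Skip.

Definition shift_step : cmd :=
  If (NLe (NConst 1) (NGet 2 (nvar 3)))
    (RSet 1 (nvar 3) (RAdd (RGet 0 (nvar 3)) (RDiv (rvar 2) (RConst 2))))
    (RSet 1 (nvar 3) (RSub (RGet 0 (nvar 3)) (RDiv (rvar 2) (RConst 2)))).

Definition inverse_matroid : cmd :=
  Seq (RSet 2 (NConst 0) (RConst 0))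
    (Seq (for_loop 3 (for_loop 4 gap_step)) (for_loop 3 shift_step)).

(* Natural variable 7 is the heaviest unscanned element found so far; natural
   variable 6 tells whether there is one. *)
Definition select_step : cmd :=
  If (BAnd (NLe (NConst 1) (NGet 1 (nvar 4)))
       (BNot (BAnd (NLe (NConst 1) (nvar 6))
         (RLe (RGet 0 (nvar 4)) (RGet 0 (nvar 7))))))
    (Seq (NSet 6 (NConst 0) (NConst 1)) (NSet 7 (NConst 0) (nvar 4)))
    Skip.

Definition insert_step : cmd :=
  If (NLe (NConst 1) (nvar 6))
    (Seq (NSet 1 (nvar 7) (NConst 0))
    (Seq (NSet 2 (nvar 7) (NConst 1))
    (Seq (Query 5 (NConst 0) 2)
      (If (NLe (NConst 1) (nvar 5)) Skip (NSet 2 (nvar 7) (NConst 0))))))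
    Skip.

Definition greedy : cmd :=
  for_loop 3
    (Seq (NSet 6 (NConst 0) (NConst 0)) (Seq (for_loop 4 select_step) insert_step)).

(** * Invariants and correctness of the programs *)

Section Programs.
Variables (R : realType) (S : finType) (M : matroid [set: S]) (w : {ffun S -> R}).
Implicit Types (st : state R) (B U : {set S}) (s t : S).

Definition holds_weight st := forall s, rmem st 0 (enum_rank s) = w s.

(** Pairs [(t, s)] are scanned lexicographically. After the last pair, the final two clauses make
    cell 0 of real array 2 the least nonnegative exchange bound. *)
Definition gap_inv B (i j : nat) st : Prop :=
  [/\ set_of_array S (nmem st 2) = B, holds_weight st,
      0 <= rmem st 2 0,
      forall d, 0 <= d -> exchange_bound M B w d -> rmem st 2 0 <= d &
      forall t s, t \in B -> s \notin B -> s |: B :\ t \in indep M ->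
        (enum_rank t < i)%N || (enum_rank t == i :> nat) && (enum_rank s < j)%N ->
        w s - w t <= rmem st 2 0].

(** For the query, natural array 2 is turned into an indicator of [s |: B :\ t] and then back. *)
Lemma gap_stepP B (t s : S) st :
  nmem st 3 0 = enum_rank t -> nmem st 4 0 = enum_rank s ->
  gap_inv B (enum_rank t) (enum_rank s) st ->
  let st' := run (indep_oracle M) gap_step st in
  [/\ forall a, a \in [:: 0; 3; 4]%N -> nmem st' a 0 = nmem st a 0 &
      gap_inv B (enum_rank t) (enum_rank s).+1 st'].
Proof.
move=> st_t st_s [st_B st_w D0 Dleast Dbound].
have tB : (t \in B) = (0 < nmem st 2 (enum_rank t))%N by rewrite -st_B inE lt0n.
have sB : (s \in B) = ~~ (nmem st 2 (enum_rank s) <= 0)%N.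
  by rewrite -st_B inE leqn0.
rewrite /= st_t st_s -tB -[(_ <= 0)%N]negbK -sB.
have [/andP[tInB sNInB] | skip] := ifP; last first.
  split=> //; split=> // t1 s1 t1B s1NB I; rewrite enum_rank_ltnS eq_enum_rank.
  case/orP=> [lt1 | /andP[/eqP et /orP[/eqP es | lt1]]].
  - by apply: Dbound; rewrite ?lt1.
  - by move: skip; rewrite -et -es t1B s1NB.
  - by apply: Dbound; rewrite ?et ?eqxx ?lt1 ?orbT // -et.
rewrite !updateE /= st_t st_s /indep_oracle !set_of_array_update /= st_B !st_w.
set st1 := nset _ 2 (enum_rank t) 1.
(* The cell of [t] is restored to 1, perhaps not its former value, so it is the represented set that
   is recovered. *)
have st1_B : set_of_array S (nmem st1 2) = B.
  rewrite /st1 /= !set_of_array_update /= st_B; apply/setP=> x; rewrite !inE.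
  have [-> | _] := eqVneq x t; first by rewrite tInB.
  by have [-> | //] := eqVneq x s; rewrite (negbTE sNInB).
have st1_v a : a \in [:: 0; 3; 4]%N -> nmem st1 a 0 = nmem st a 0.
  by rewrite !inE => /or3P[] /eqP ->; rewrite /st1 /= !updateE.
have [/andP[I lt_D] | skip] := ifP; split=> //; split=> //=.
- by rewrite /update /= -ltNge in lt_D *; lra.
- move=> d d0 bound; rewrite /update /=.
  by apply: bound => //; move: I; case: (_ \in _).
- rewrite /update /= => t1 s1 t1B s1NB I1; rewrite enum_rank_ltnS eq_enum_rank.
  rewrite -ltNge in lt_D.
  case/orP=> [lt1 | /andP[/eqP et /orP[/eqP es | lt1]]].
  + by apply: le_trans (Dbound _ _ t1B s1NB I1 _) (ltW lt_D); rewrite lt1.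
  + by rewrite et es.
  + apply: le_trans (Dbound _ _ t1B s1NB I1 _) (ltW lt_D).
    by rewrite et eqxx lt1 orbT.
move=> t1 s1 t1B s1NB I1; rewrite enum_rank_ltnS eq_enum_rank.
case/orP=> [lt1 | /andP[/eqP et /orP[/eqP es | lt1]]].
- by apply: Dbound; rewrite ?lt1.
- by move: skip; rewrite -et -es I1 /= => /negbFE.
- by apply: Dbound; rewrite // et eqxx lt1 orbT.
Qed.

Lemma gap_loopP B st : nmem st 0 0 = #|S| -> gap_inv B 0 0 st ->
  terminates_within (indep_oracle M) (for_loop 3 (for_loop 4 gap_step)) st
    (#|S| * (#|S| * (max_cost gap_step + 13) + 10 + 13) + 10)
    (fun st' => nmem st' 0 0 = #|S| /\ gap_inv B #|S| 0 st').
Proof.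
move=> st_n inv0; apply: (terminates_for (Inv := fun i => gap_inv B i 0)) => //.
move=> i st1 lt_i st1_i st1_n inv1; have [t et] := ltn_enum_rank lt_i.
rewrite -et {i et lt_i} in st1_i inv1 *.
apply: terminates_weaken (leqnn _) _.
  apply: (terminates_for (Inv := fun j st' => nmem st' 3 0 = enum_rank t /\
    gap_inv B (enum_rank t) j st')) => //.
  move=> j st2 lt_j st2_j st2_n [st2_t inv2]; have [s es] := ltn_enum_rank lt_j.
  rewrite -es {j es lt_j} in st2_j inv2 *.
  have [keep inv3] := gap_stepP st2_t st2_j inv2.
  apply: terminates_run => //; move: (run _ _ _) keep inv3 => st3 keep inv3.
  by split; rewrite ?keep //=; split; rewrite /= ?updateE ?keep.
(* A finished row [(enum_rank t, #|S|)] is the start [((enum_rank t).+1, 0)] of the next, because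
   every rank is below [#|S|]. *)
move=> st2 [st2_n [st2_t [st2_B st2_w D0 Dleast Dbound]]]; split=> //.
split=> // t1 s1 t1B s1NB I; rewrite enum_rank_ltnS ltn0 andbF orbF => lt1.
by apply: Dbound; rewrite // ltn_ord andbT eq_enum_rank orbC.
Qed.

Lemma shift_loopP B d st : nmem st 0 0 = #|S| ->
  set_of_array S (nmem st 2) = B -> holds_weight st -> rmem st 2 0 = d ->
  terminates_within (indep_oracle M) (for_loop 3 shift_step) st
    (#|S| * (max_cost shift_step + 13) + 10)
    (fun st' => set_of_array S (nmem st' 2) = B /\
      output_weight S st' = shift w B (d / 2)).
Proof.
move=> st_n st_B st_w st_d.
pose Inv (i : nat) (st' : state R) := [/\ set_of_array S (nmem st' 2) = B,
  holds_weight st', rmem st' 2 0 = d &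
  forall s, (enum_rank s < i)%N -> rmem st' 1 (enum_rank s) = shift w B (d / 2) s].
apply: terminates_weaken (leqnn _) _.
  apply: (terminates_for (Inv := Inv)) => // i st1 lt_i st1_i st1_n.
  have [t et] := ltn_enum_rank lt_i; rewrite -et {i et lt_i} in st1_i *.
  move=> [st1_B st1_w st1_d st1_s]; apply: terminates_run => //=.
  have -> : (0 < nmem st1 2 (nmem st1 3 0))%N = (t \in B).
    by rewrite -st1_B inE lt0n st1_i.
  rewrite st1_i st1_w.
  have inv v : v = shift w B (d / 2) t ->
      Inv (enum_rank t).+1 (nset (rset st1 1 (enum_rank t) v) 3 0 (enum_rank t).+1).
    move=> ->; split=> // s; rewrite enum_rank_ltnS /= updateE eq_enum_rank /=.
    by case: eqP => [-> // | _]; apply: st1_s.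
  by case: ifP => tB; split=> //; apply: inv; rewrite ffunE tB st1_d.
move=> st1 [_ [st1_B _ _ st1_s]]; split=> //.
by apply/ffunP=> s; rewrite ffunE st1_s.
Qed.

Lemma inverse_matroidP B st : basis M B -> nmem st 0 0 = #|S| ->
  set_of_array S (nmem st 2) = B -> holds_weight st ->
  terminates_within (indep_oracle M) inverse_matroid st (200 * #|S|.+1 ^ 2)
    (fun st' => set_of_array S (nmem st' 2) = B /\
      IM_optimal M B w (output_weight S st')).
Proof.
move=> bB st_n st_B st_w.
have init : terminates_within (indep_oracle M) (RSet 2 (NConst 0) (RConst 0)) st 3
    (fun st1 => nmem st1 0 0 = #|S| /\ gap_inv B 0 0 st1).
  apply: (terminates_run (c := RSet 2 (NConst 0) (RConst 0))) => //=; split=> //.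
  by split=> // t s _ _ _; rewrite !ltn0 andbF.
have loops st1 : nmem st1 0 0 = #|S| /\ gap_inv B 0 0 st1 ->
    terminates_within (indep_oracle M)
      (Seq (for_loop 3 (for_loop 4 gap_step)) (for_loop 3 shift_step)) st1
      (#|S| * (#|S| * (max_cost gap_step + 13) + 10 + 13) + 10 +
       (#|S| * (max_cost shift_step + 13) + 10))
      (fun st' => set_of_array S (nmem st' 2) = B /\
        IM_optimal M B w (output_weight S st')).
  case=> st1_n inv1; apply: terminates_seq (gap_loopP st1_n inv1) _.
  move=> st2 [st2_n [st2_B st2_w D0 Dleast Dbound]].
  apply: terminates_weaken (shift_loopP st2_n st2_B st2_w erefl) (leqnn _) _.
  move=> st3 [st3_B ->]; split=> //; apply: IM_optimal_shift => //.
  - by rewrite divr_ge0.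
  - move=> t s tB sNB I; rewrite mulr2n -splitr; apply: Dbound => //.
    by rewrite ltn_ord.
  - move=> d d0 bound; rewrite ler_pdivrMr // mulr_natr; apply: Dleast => //.
    exact: mulrn_wge0.
apply: terminates_weaken (terminates_seq init loops) _ _ => //.
(* The nested loops make the cost quadratic in [#|S|]; 200 absorbs the fixed costs of the bodies. *)
by rewrite /=; nia.
Qed.

Definition select_inv U B (j : nat) st : Prop :=
  [/\ set_of_array S (nmem st 1) = U, set_of_array S (nmem st 2) = B,
      holds_weight st,
      (0 < nmem st 6 0)%N -> exists e, [/\ nmem st 7 0 = enum_rank e, e \in U &
        forall u, u \in U -> (enum_rank u < j)%N -> w u <= w e] &
      nmem st 6 0 = 0%N -> forall u, u \in U -> (j <= enum_rank u)%N].

Lemma select_stepP U B s st :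
  nmem st 4 0 = enum_rank s -> select_inv U B (enum_rank s) st ->
  let st' := run (indep_oracle M) select_step st in
  [/\ forall a, a \in [:: 0; 3; 4]%N -> nmem st' a 0 = nmem st a 0 &
      select_inv U B (enum_rank s).+1 st'].
Proof.
move=> st_s [st_U st_B st_w sel unsel] /=.
have -> : (0 < nmem st 1 (nmem st 4 0))%N = (s \in U).
  by rewrite -st_U inE lt0n st_s.
have [/andP[sU best] | skip] := ifP.
  split=> [a|]; first by rewrite !inE => /or3P[] /eqP ->; rewrite /= !updateE.
  split=> //= _; exists s; rewrite !updateE /=; split=> // u uU.
  rewrite enum_rank_ltnS => /orP[/eqP -> // | lt_us].
  (* Without an earlier candidate no element of [U] precedes [s]; otherwise the candidate being
     replaced is lighter than [s]. *)
  case: (posnP (nmem st 6 0)) => [n6 | p6].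
    by have := unsel n6 u uU; rewrite leqNgt lt_us.
  have [e [st_e eU emax]] := sel p6.
  apply: le_trans (emax u uU lt_us) _; move: best.
  by rewrite p6 st_e st_s !st_w -ltNge => /ltW.
split=> //; split=> // [p6 | n6 u uU]; last first.
  rewrite ltn_neqAle unsel // andbT eq_enum_rank; apply/eqP=> us.
  by move: skip; rewrite us uU n6.
have [e [st_e eU emax]] := sel p6; exists e; split=> // u uU.
rewrite enum_rank_ltnS => /orP[/eqP us | lt_us]; last exact: emax.
by move: skip; rewrite -us uU p6 st_e st_s !st_w -us /= => /negbFE.
Qed.

(** Natural array 1 starts as [S0] and is consumed as the set of unscanned elements. The outer loop
    makes [#|S|] rounds whatever the size of [S0], and the cardinality clause shows that this
    exhausts them. *)
Definition scan_inv (S0 : {set S}) (k : nat) st : Prop :=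
  [/\ greedy_inv M S0 w (set_of_array S (nmem st 1)) (set_of_array S (nmem st 2)),
      holds_weight st & (#|set_of_array S (nmem st 1)| <= #|S| - k)%N].

Lemma insert_stepP (S0 U B : {set S}) (k : nat) st :
  select_inv U B #|S| st -> greedy_inv M S0 w U B -> (#|U| <= #|S| - k)%N ->
  let st' := run (indep_oracle M) insert_step st in
  [/\ nmem st' 0 0 = nmem st 0 0, nmem st' 3 0 = nmem st 3 0 & scan_inv S0 k.+1 st'].
Proof.
move=> [st_U st_B st_w sel unsel] inv le_U /=.
(* With no candidate after a full scan, [U] is already empty and the round is idle. *)
case: (posnP (nmem st 6 0)) => [n6 | p6].
  have U0 : U = set0.
    apply/setP=> u; rewrite inE; apply/negP=> uU.
    by have := unsel n6 u uU; rewrite leqNgt ltn_ord.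
  by split=> //; split=> //; rewrite ?st_U ?st_B // U0 cards0.
have [e [st_e eU emax]] := sel p6.
have inv' := greedy_inv_step inv eU (fun u uU => emax u uU (ltn_ord _)).
(* This ensures that undoing the tentative insertion of [e] gives back [B]. *)
have eNB : e \notin B.
  by apply/negP=> /(subsetP (greedy_subB inv)); rewrite inE eU.
have le_U' : (#|U :\ e| <= #|S| - k.+1)%N.
  by have := cardsD1 e U; rewrite eU; lia.
rewrite !updateE /= st_e /indep_oracle !set_of_array_update /= st_B.
by case: ifP inv' => [|] I inv'; split=> //; split=> //=;
  rewrite !set_of_array_update /= ?st_U ?st_B ?setU1K.
Qed.

Lemma greedyP (S0 : {set S}) st : nmem st 0 0 = #|S| ->
  set_of_array S (nmem st 1) = S0 -> set_of_array S (nmem st 2) = set0 ->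
  holds_weight st ->
  terminates_within (indep_oracle M) greedy st (200 * #|S|.+1 ^ 2)
    (fun st' => [/\ nmem st' 0 0 = #|S|, holds_weight st' &
      max_weight_basis (restriction M S0) w (set_of_array S (nmem st' 2))]).
Proof.
move=> st_n st_S0 st_B st_w.
have step i st1 : nmem st1 3 0 = i -> nmem st1 0 0 = #|S| -> scan_inv S0 i st1 ->
    terminates_within (indep_oracle M)
      (Seq (NSet 6 (NConst 0) (NConst 0))
        (Seq (for_loop 4 select_step) insert_step)) st1
      (3 + (#|S| * (max_cost select_step + 13) + 10 + max_cost insert_step))
      (fun st' => [/\ nmem st' 3 0 = i, nmem st' 0 0 = #|S| &
        scan_inv S0 i.+1 (nset st' 3 0 i.+1)]).
  move=> st1_i st1_n [inv1 st1_w le1].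
  set U := set_of_array S (nmem st1 1) in inv1 le1.
  set B := set_of_array S (nmem st1 2) in inv1.
  pose Inv j (st' : state R) := nmem st' 3 0 = i /\ select_inv U B j st'.
  apply: (terminates_seq (P := fun st2 => nmem st2 0 0 = #|S| /\ Inv 0%N st2)).
    exact: (terminates_run (c := NSet 6 (NConst 0) (NConst 0))).
  move=> st2 [st2_n inv2]; apply: terminates_seq.
    apply: (terminates_for (Inv := Inv)) => // j st3 lt_j st3_j st3_n [st3_i inv3].
    have [s es] := ltn_enum_rank lt_j; rewrite -es {j es lt_j} in st3_j inv3 *.
    have [keep inv4] := select_stepP st3_j inv3.
    apply: terminates_run => //; move: (run _ _ _) keep inv4 => st4 keep inv4.
    by split; rewrite ?keep //=; split; rewrite /= ?updateE ?keep.
  move=> st3 [st3_n [st3_i inv3]]; apply: terminates_run => //.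
  by have [-> -> inv4] := insert_stepP inv3 inv1 le1.
have inv0 : scan_inv S0 0 (nset st 3 0 0).
  split=> //=; last by rewrite subn0 max_card.
  by rewrite [set_of_array S _]st_S0 [X in greedy_inv _ _ _ _ X]st_B; exact: greedy_inv0.
apply: terminates_weaken (terminates_for _ st_n inv0 (fun i st1 _ => @step i st1)) _ _.
- by [].
- by rewrite /=; nia.
(* After [#|S|] rounds the cardinality clause leaves no unscanned element. *)
move=> st1 [st1_n [inv1 st1_w]]; rewrite subnn leqn0 cards_eq0 => /eqP U0.
by split=> //; apply: greedy_inv_max_weight; rewrite -U0.
Qed.

End Programs.

Section Input.
Variables (R : realType) (S : finType) (S0 B : {set S}) (w : {ffun S -> R}).

Lemma input_holds_weight : holds_weight w (input S0 B w).
Proof. by move=> s; exact: array_of_enum_rank. Qed.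

Lemma input_ground : set_of_array S (nmem (input S0 B w) 1) = S0.
Proof. exact: set_of_array_nat_of_bool. Qed.

Lemma input_basis : set_of_array S (nmem (input S0 B w) 2) = B.
Proof. exact: set_of_array_nat_of_bool. Qed.

End Input.

(** Polynomial time is given in two readings: [B0] is to be found from [S0], or [B0] is part of the
    input. In each, one program and one pair of constants serve all instances. *)
Theorem theorem4p5 (R : realType) :
  [/\ forall (S : finType) (M : matroid [set: S]) (S0 : {set S})
             (w : {ffun S -> R}),
        (exists2 B, basis M B & B \subset S0) ->
        forall (B0 : {set S}) (wstar : {ffun S -> R}),
          max_weight_basis (restriction M S0) w B0 ->
          IM_optimal M B0 w wstar ->
          IM_exists_optimal M S0 w wstar,
      exists (c : cmd) (K d : nat),
      forall (S : finType) (M : matroid [set: S]) (S0 : {set S})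
             (w : {ffun S -> R}),
        (exists2 B, basis M B & B \subset S0) ->
        terminates_within (indep_oracle M) c (input S0 set0 w)
          (K * #|S|.+1 ^ d)%N
          (fun st =>
             max_weight_basis (restriction M S0) w (output_basis S st) /\
             IM_optimal M (output_basis S st) w (output_weight S st))
    & exists (c : cmd) (K d : nat),
      forall (S : finType) (M : matroid [set: S]) (S0 : {set S})
             (w : {ffun S -> R}),
        (exists2 B, basis M B & B \subset S0) ->
        forall B0 : {set S},
          max_weight_basis (restriction M S0) w B0 ->
          terminates_within (indep_oracle M) c (input S0 B0 w)
            (K * #|S|.+1 ^ d)%N
            (fun st => IM_optimal M B0 w (output_weight S st))].
Proof.
split; first by move=> S M S0 w; exact: IM_exists_of_IM.
  (* The greedy phase leaves its basis in natural array 2 and keeps the size and the weights. This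
     is all that [inverse_matroidP] asks of its initial memory, so leftover scratch values are
     harmless. *)
  exists (Seq greedy inverse_matroid), 400%N, 2%N => S M S0 w [A bA AS0].
  have run_greedy := greedyP M (erefl : nmem (input S0 set0 w) 0 0 = #|S|)
    (input_ground _ _ _) (input_basis _ _ _) (input_holds_weight _ _ _).
  rewrite (_ : 400 = 200 + 200)%N // mulnDl; apply: terminates_seq run_greedy _.
  move=> st [st_n st_w mB]; have [b0 _] := mB.
  have [_ bB] := basis_restriction bA AS0 b0.
  apply: terminates_weaken (inverse_matroidP bB st_n erefl st_w) (leqnn _) _.
  by move=> st' [st'_B opt]; rewrite /output_basis st'_B.
(* Here [B0] is already in natural array 2, so the second phase alone suffices. *)
exists inverse_matroid, 200%N, 2%N => S M S0 w [A bA AS0] B0 [b0 _].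
have [_ bB0] := basis_restriction bA AS0 b0.
apply: terminates_weaken (inverse_matroidP bB0 _ (input_basis _ _ _)
  (input_holds_weight _ _ _)) (leqnn _) _ => //.
by move=> st' [_ opt].
Qed.
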